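(* Let $R$ be an integral domain that is a finitely generated algebra over a field. Then $\operatorname{udim} R\le\dim R$, where $\dim R$ is the Krull dimension of $R$ and $\operatorname{udim} R$ its unit dimension.
   Context: All rings are commutative and unital. A ring $R$ is unit-additive if whenever $u,v$ are units of $R$, $u+v$ is either a unit of $R$ or a nilpotent element. The saturation of a multiplicative set $W\subseteq R$ is $\widetilde W=\{x\in R\mid \exists y\in R,\ xy\in W\}$. Unit dimension: let $R$ be a ring whose nilradical is a prime ideal (e.g. a domain). Set $W_0=\{1\}$ and $V_0=\widetilde{W_0}=U(R)$ (the units of $R$). For each $i\ge1$ define inductively $W_i$ to be the set of non-nilpotent (finite) sums of elements of $V_{i-1}$ (this set is multiplicatively closed) and $V_i=\widetilde{W_i}$. Then $\operatorname{udim} R$ is the smallest integer $n\ge0$ such that $W_n^{-1}R$ is unit-additive, and $\operatorname{udim} R=\infty$ if no such $n$ exists. *)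

(* Defs.v *)
From HB Require Import structures.
From mathcomp Require Import all_boot all_order all_algebra.
From mathcomp Require Import generic_quotient ring_quotient ring.
From mathcomp Require Import boolp constructive_ereal.
From mathcomp Require mpoly.

Set Implicit Arguments.
Unset Strict Implicit.
Unset Printing Implicit Defensive.

Import GRing.Theory.

Local Open Scope ring_scope.
Local Open Scope quotient_scope.

(* GRing.unit needs a ring equipped with an inverse function, which the
   localizations constructed below are not. *)
Definition is_unit (R : comPzRingType) (x : R) : Prop := exists y, x * y = 1.

Definition nilpotent_elt (R : comPzRingType) (x : R) : Prop :=
  exists n : nat, x ^+ n = 0.

Definition unit_additive (R : comPzRingType) : Prop :=
  forall u v : R, is_unit u -> is_unit v ->
    is_unit (u + v) \/ nilpotent_elt (u + v).

Definition mult_set (R : comPzRingType) (W : R -> Prop) : Prop :=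
  W 1 /\ forall x y, W x -> W y -> W (x * y).

Definition saturation (R : comPzRingType) (W : R -> Prop) : R -> Prop :=
  fun x => exists y, W (x * y).

(* W^-1 R for a multiplicative set W, possibly with zero divisors: the quotient
   of R * W by (a, s) ~ (b, t) <-> u (a t - b s) = 0 for some u in W. *)
Module Localization.
Section Localization.

Variables (R : comPzRingType) (W : R -> Prop) (mW : mult_set W).

Definition prefrac := {p : R * R | `[< W p.2 >]}.

Implicit Types p q r : prefrac.

Definition num p : R := (val p).1.
Definition den p : R := (val p).2.

Lemma denP p : W (den p). Proof. exact: asboolW (valP p). Qed.

Definition mkfrac (a s : R) (Ws : W s) : prefrac :=
  exist _ (a, s) (introT (asboolP (W s)) Ws).

Definition equiv p q : bool :=
  `[< exists2 u, W u & u * (num p * den q - num q * den p) = 0 >].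

Lemma equiv_refl : reflexive equiv.
Proof.
by move=> p; apply/asboolP; exists 1; [exact: mW.1 | rewrite subrr mulr0].
Qed.

Lemma equiv_sym : symmetric equiv.
Proof.
have sub p q : equiv p q -> equiv q p.
  move=> /asboolP[u Wu E]; apply/asboolP; exists u => //.
  by rewrite -opprB mulrN E oppr0.
by move=> p q; apply/idP/idP; apply: sub.
Qed.

Lemma equiv_trans : transitive equiv.
Proof.
move=> q p r /asboolP[u Wu E] /asboolP[v Wv F]; apply/asboolP.
exists (u * v * den q); first by apply/mW.2/denP; apply: mW.2.
have -> : u * v * den q * (num p * den r - num r * den p) =
    v * den r * (u * (num p * den q - num q * den p)) +
    u * den p * (v * (num q * den r - num r * den q)) by ring.
by rewrite E F !mulr0 addr0.
Qed.

Canonical equiv_equiv := EquivRel equiv equiv_refl equiv_sym equiv_trans.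

Definition type := {eq_quot equiv}.

HB.instance Definition _ : EqQuotient _ equiv type := EqQuotient.on type.
HB.instance Definition _ := Choice.on type.

Lemma piP p q : reflect
  (exists2 u, W u & u * (num p * den q - num q * den p) = 0)
  (p == q %[mod type]).
Proof. by rewrite eqmodE; apply: asboolP. Qed.

Lemma pi_eq p q : num p * den q = num q * den p -> \pi_type p = \pi_type q.
Proof.
move=> E; apply/eqP/piP; exists 1; first exact: mW.1.
by rewrite E subrr mulr0.
Qed.

Lemma repr_pi p : exists2 u, W u &
  u * (num p * den (repr (\pi_type p)) - num (repr (\pi_type p)) * den p) = 0.
Proof. by apply/piP; rewrite reprK. Qed.

Definition zerof := mkfrac 0 mW.1.
Definition onef := mkfrac 1 mW.1.
Definition oppf p := mkfrac (- num p) (denP p).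
Definition addf p q :=
  mkfrac (num p * den q + num q * den p) (mW.2 _ _ (denP p) (denP q)).
Definition mulf p q := mkfrac (num p * num q) (mW.2 _ _ (denP p) (denP q)).

Definition zero : type := \pi zerof.
Definition one : type := \pi onef.
Definition opp := lift_op1 type oppf.
Definition add := lift_op2 type addf.
Definition mul := lift_op2 type mulf.

Lemma pi_opp : {morph \pi : p / oppf p >-> opp p}.
Proof.
move=> p; unlock opp; apply/eqP/piP; have [u Wu E] := repr_pi p.
exists u => //; rewrite /oppf /num /den /= -/(num _) -/(den _).
rewrite -[RHS]oppr0 -E /num /den; ring.
Qed.
Canonical pi_opp_morph := PiMorph1 pi_opp.

Lemma pi_add : {morph \pi : p q / addf p q >-> add p q}.
Proof.
move=> p q; unlock add; apply/eqP/piP.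
have [u Wu E] := repr_pi p; have [v Wv F] := repr_pi q.
move: (repr _) (repr _) E F => q' p' E F.
exists (u * v); first exact: mW.2.
have -> : u * v * (num (addf p q) * den (addf p' q') -
                   num (addf p' q') * den (addf p q)) =
    v * den q * den q' * (u * (num p * den p' - num p' * den p)) +
    u * den p * den p' * (v * (num q * den q' - num q' * den q)).
  rewrite {1 2 3 4}/num {1 2 3 4}/den /=; ring.
by rewrite E F !mulr0 addr0.
Qed.
Canonical pi_add_morph := PiMorph2 pi_add.

Lemma pi_mul : {morph \pi : p q / mulf p q >-> mul p q}.
Proof.
move=> p q; unlock mul; apply/eqP/piP.
have [u Wu E] := repr_pi p; have [v Wv F] := repr_pi q.
move: (repr _) (repr _) E F => q' p' E F.
exists (u * v); first exact: mW.2.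
have -> : u * v * (num (mulf p q) * den (mulf p' q') -
                   num (mulf p' q') * den (mulf p q)) =
    v * num q * den q' * (u * (num p * den p' - num p' * den p)) +
    u * num p' * den p * (v * (num q * den q' - num q' * den q)).
  rewrite {1 2 3 4}/num {1 2 3 4}/den /=; ring.
by rewrite E F !mulr0 addr0.
Qed.
Canonical pi_mul_morph := PiMorph2 pi_mul.

Lemma addA : associative add.
Proof.
elim/quotW=> p; elim/quotW=> q; elim/quotW=> r; rewrite !piE.
by apply: pi_eq; rewrite /num /den /= /num /den /=; ring.
Qed.

Lemma addC : commutative add.
Proof.
elim/quotW=> p; elim/quotW=> q; rewrite !piE.
by apply: pi_eq; rewrite /num /den /= /num /den /=; ring.
Qed.

Lemma add0 : left_id zero add.
Proof.
elim/quotW=> p; rewrite /zero !piE.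
by apply: pi_eq; rewrite /num /den /= /num /den /=; ring.
Qed.

Lemma addN : left_inverse zero opp add.
Proof.
elim/quotW=> p; rewrite /zero !piE.
by apply: pi_eq; rewrite /num /den /= /num /den /=; ring.
Qed.

HB.instance Definition _ := GRing.isZmodule.Build type addA addC add0 addN.

Lemma mulA : associative mul.
Proof.
elim/quotW=> p; elim/quotW=> q; elim/quotW=> r; rewrite !piE.
by apply: pi_eq; rewrite /num /den /= /num /den /=; ring.
Qed.

Lemma mulC : commutative mul.
Proof.
elim/quotW=> p; elim/quotW=> q; rewrite !piE.
by apply: pi_eq; rewrite /num /den /= /num /den /=; ring.
Qed.

Lemma mul1 : left_id one mul.
Proof.
elim/quotW=> p; rewrite /one !piE.
by apply: pi_eq; rewrite /num /den /= /num /den /=; ring.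
Qed.

Lemma mulDl : left_distributive mul add.
Proof.
elim/quotW=> p; elim/quotW=> q; elim/quotW=> r; rewrite !piE.
by apply: pi_eq; rewrite /num /den /= /num /den /=; ring.
Qed.

HB.instance Definition _ :=
  GRing.Zmodule_isComPzRing.Build type mulA mulC mul1 mulDl.

End Localization.
End Localization.
HB.export Localization.

Notation localization := Localization.type.

Definition prime_ideal (R : comNzRingType) (P : {pred R}) : Prop :=
  idealr_closed P /\ prime_idealr_closed P.

Definition nilradical (R : comNzRingType) : {pred R} :=
  fun x : R => `[< nilpotent_elt x >].
Arguments nilradical R : clear implicits.

Definition least_or_infty (P : nat -> Prop) : \bar int :=
  if pselect (exists n, `[< P n >]) is left ex then (Posz (ex_minn ex))%:E
  else +oo%E.

Section UnitDimension.

Variable R : comNzRingType.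

Fixpoint udimW (n : nat) : R -> Prop :=
  if n is m.+1 then
    fun x => ~ nilpotent_elt x /\
      exists2 s : seq R, (forall y, y \in s -> saturation (udimW m) y)
                       & x = \sum_(y <- s) y
  else fun x => x = 1.

Variable prime_nil : prime_ideal (nilradical R).

Lemma udimW_mult_set n : mult_set (udimW n).
Proof.
case: prime_nil => -[_ nil1 _] nilM.
elim: n => [|n [IH1 IHM]] /=; first by split=> // x y -> ->; rewrite mulr1.
split.
  split; first by move=> N; case/negP: nil1; apply/asboolP.
  exists [:: 1]; last by rewrite big_seq1.
  by move=> y; rewrite inE => /eqP ->; exists 1; rewrite mulr1.
move=> x y [Nx [s Vs Ex]] [Ny [t Vt Ey]]; split.
  by move=> /asboolP/nilM/orP[] /asboolP.
exists [seq a * b | a <- s, b <- t].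
  move=> _ /allpairsP[[a b] /= [/Vs[a' Wa] /Vt[b' Wb] ->]].
  by exists (a' * b'); rewrite mulrACA; apply: IHM.
rewrite big_allpairs_dep Ex Ey mulr_suml; apply: eq_bigr => a _.
by rewrite mulr_sumr.
Qed.

Definition udim : \bar int :=
  least_or_infty (fun n => unit_additive (localization (udimW_mult_set n))).

End UnitDimension.

Lemma domain_prime_nilradical (R : idomainType) : prime_ideal (nilradical R).
Proof.
have nilE (x : R) : (x \in nilradical R) = (x == 0).
  apply/asboolP/eqP=> [[n /eqP]|->]; last by exists 1; rewrite expr1.
  by rewrite expf_eq0 => /andP[_ /eqP].
split=> [|u v]; last by rewrite !nilE mulf_eq0.
split=> [||a u v]; rewrite !nilE ?oner_eq0 // => /eqP-> /eqP->.
by rewrite mulr0 addr0.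
Qed.

Definition prime_chain (R : comNzRingType) (n : nat) : Prop :=
  exists P : nat -> {pred R},
    (forall i, (i <= n)%N -> prime_ideal (P i)) /\
    (forall i, (i < n)%N ->
       {subset P i <= P i.+1} /\ ~ {subset P i.+1 <= P i}).

(* Supremum of the lengths of the chains of primes, as their least upper bound
   in the extended naturals; R is nonzero, so there is a chain of length 0. *)
Definition krull_dim (R : comNzRingType) : \bar int :=
  least_or_infty (fun b => forall n, prime_chain R n -> (n <= b)%N).

(* phi makes R a k-algebra, which is a quotient of some k[X_1, ..., X_n]. *)
Definition finite_type (k R : comNzRingType) (phi : {rmorphism k -> R}) : Prop :=
  exists (n : nat) (x : 'I_n -> R),
    forall r : R, exists p : mpoly.mpoly n k, r = mpoly.mmap phi x p.

(* Main.v *)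
(* Write V n for the saturation of W n. The heart of the matter is that if a
   prime P misses W (n+1) and W_n^-1 R is not unit-additive, then some prime
   strictly above P misses W n; starting from P = 0 and n = dim R, this
   descends to W 0 and builds a chain of primes longer than dim R allows. If
   there is no such prime, then R/P localized at W n is a field K, finitely
   generated over the fraction field of the image of A, where A is k if n =
   0 and the ring W n u {0} otherwise; by Zariski's lemma K is algebraic
   over A. As W_n^-1 R is not unit-additive, there is an s in W (n+1)
   outside V n. A multiple t = bs with b in A is integral over A modulo P,
   and the integral equation holds in R itself, because its value lies in W
   (n+1) u {0}, which meets P only in 0. Then t divides the lowest nonzero
   coefficient, an element of V n, so s is in V n, a contradiction. *)

From HB Require Import structures.
Require Import Defs.
From mathcomp Require Import all_boot all_order all_algebra.
From mathcomp Require Import ring_quotient fraction ring generic_quotient.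
From mathcomp Require Import boolp classical_sets constructive_ereal.

Set Implicit Arguments.
Unset Strict Implicit.
Unset Printing Implicit Defensive.

Import GRing.Theory.

Local Open Scope ring_scope.
Local Open Scope quotient_scope.

(** * Integral and algebraic elements over the image of a ring *)

(** Cancelling the largest power of ['X] from [p] keeps the nonzero [t] as a root, and the new
    constant term is then a multiple of [t]. *)
Lemma root_dvd_coef (D : idomainType) (p : {poly D}) (t : D) :
    p != 0 -> root p t -> t != 0 ->
  exists2 m, p`_m != 0 & p`_m = - (t * (drop_poly m.+1 p).[t]).
Proof.
move=> + + t0; elim/poly_ind: p => [|p c IHp]; first by rewrite eqxx.
have dropS m : drop_poly m.+1 (p * 'X + c%:P) = drop_poly m p.
  by apply/polyP => i; rewrite !coef_drop_poly addnS coefD coefMX coefC addr0.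
have [c0|c0] := eqVneq c 0; last first.
  move=> _ /rootP; rewrite !hornerE => E; exists 0.
    by rewrite coefD coefMX coefC add0r.
  rewrite dropS drop_poly0l coefD coefMX coefC add0r /=.
  by apply/eqP; rewrite -addr_eq0 addrC mulrC E.
move: dropS; rewrite c0 polyC0 addr0 => dropS pX0.
have p0 : p != 0 by apply: contraNneq pX0 => ->; rewrite mul0r.
rewrite rootM rootX (negPf t0) orbF => /(IHp p0)[m pm0 Em].
by exists m.+1; rewrite ?dropS !coefMX /= -?Em.
Qed.

Section AlgebraicElements.

Variables (A : comNzRingType) (K : fieldType) (f : {rmorphism A -> K}).

(** Algebraicity over the fraction field of the image of [f], with denominators cleared. *)
Definition alg_over (z : K) : Prop :=
  exists2 b, f b != 0 & integralOver f (f b * z).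

Lemma integral_alg z : integralOver f z -> alg_over z.
Proof. by exists 1; rewrite rmorph1 ?oner_eq0 ?mul1r. Qed.

Lemma alg_over_id a : alg_over (f a).
Proof. exact/integral_alg/integral_id. Qed.

Lemma alg_over_sub x y : alg_over x -> alg_over y -> alg_over (x - y).
Proof.
move=> [b b0 bx] [c c0 cy]; exists (b * c); first by rewrite rmorphM mulf_neq0.
rewrite rmorphM mulrBr; apply: integral_sub.
  by rewrite mulrAC; apply: integral_mul => //; exact: integral_id.
by rewrite -mulrA; apply: integral_mul => //; exact: integral_id.
Qed.

Lemma alg_over_add x y : alg_over x -> alg_over y -> alg_over (x + y).
Proof.
move=> algx algy; rewrite -[y]opprK -[- y]sub0r -(rmorph0 f).
by do 2!apply: alg_over_sub => //; exact: alg_over_id.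
Qed.

Lemma alg_over_mul x y : alg_over x -> alg_over y -> alg_over (x * y).
Proof.
move=> [b b0 bx] [c c0 cy]; exists (b * c); first by rewrite rmorphM mulf_neq0.
by rewrite rmorphM mulrACA; apply: integral_mul.
Qed.

(** The lowest nonzero coefficient in the equation of the integral multiple [t] of [z] is a multiple
    of [t], so its quotient by [z] is integral: it serves as denominator. *)
Lemma alg_over_inv z : alg_over z -> alg_over z^-1.
Proof.
have [->|z0] := eqVneq z 0; first by rewrite invr0.
move=> [b b0]; set t := f b * z => tI; have [p mon_p pt] := tI.
have t0 : t != 0 by rewrite mulf_neq0.
have p0 : map_poly f p != 0 by rewrite monic_neq0 ?monic_map.
have [m] := root_dvd_coef p0 pt t0.
rewrite coef_map /= => pm0 Em; exists p`_m => //; rewrite Em.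
have -> : - (t * (drop_poly m.+1 (map_poly f p)).[t]) / z =
    - (f b * (drop_poly m.+1 (map_poly f p)).[t]) by rewrite /t; field.
apply/integral_opp/integral_mul; first exact: integral_id.
apply: integral_horner => //; apply/integral_poly => i.
by rewrite coef_drop_poly coef_map; exact: integral_id.
Qed.

Lemma common_denominator (s : seq K) :
    (forall z, z \in s -> alg_over z) ->
  exists2 b, f b != 0 & forall z, z \in s -> integralOver f (f b * z).
Proof.
elim: s => [|x s IHs] algs; first by exists 1; rewrite // rmorph1 oner_eq0.
have [|b b0 bs] := IHs; first by move=> z zs; apply: algs; rewrite inE zs orbT.
have [|c c0 cx] := algs x; first by rewrite inE eqxx.
exists (b * c); first by rewrite rmorphM mulf_neq0.
move=> z; rewrite inE rmorphM => /predU1P[->|/bs bz].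
  by rewrite -mulrA; apply: integral_mul => //; exact: integral_id.
by rewrite mulrAC; apply: integral_mul => //; exact: integral_id.
Qed.

Lemma alg_over_root_monic (p : {poly K}) z :
  p \is monic -> root p z -> (forall i, alg_over p`_i) -> alg_over z.
Proof.
move=> mon_p pz algp; have [_ /(nthP 0)[i _ <-]//|b b0 bp] :=
  @common_denominator p.
have sp0 : (0 < size p)%N by rewrite size_poly_gt0 monic_neq0.
(* The roots of [q] are those of [p] scaled by [f b]; each coefficient below the leading one gains a
   factor [f b], which makes it integral. *)
pose q := \poly_(i < size p) (f b ^+ ((size p).-1 - i) * p`_i).
have lead_q : q`_(size p).-1 = 1.
  by rewrite coef_poly prednK // leqnn subnn mul1r; exact/eqP.
have size_q : size q = size p.
  apply/eqP; rewrite eqn_leq size_poly -(prednK sp0) ltnNge; apply/negP => le_q.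
  by have := oner_neq0 K; rewrite -lead_q nth_default ?eqxx.
exists b => //; apply: (@integral_root_monic _ _ _ _ q).
- by rewrite monicE lead_coefE size_q lead_q.
- apply/rootP; rewrite horner_poly.
  transitivity (f b ^+ (size p).-1 * p.[z]); last by rewrite (rootP pz) mulr0.
  rewrite horner_coef mulr_sumr.
  apply: eq_bigr => i _; rewrite exprMn mulrACA -exprD subnK //.
  by rewrite -ltnS prednK.
apply/integral_poly => i; rewrite coef_poly; case: ifP => [ip|_]; last first.
  exact: integral0.
have [->|ne_i] := eqVneq i (size p).-1.
  by rewrite subnn mul1r -lead_coefE (eqP mon_p); exact: integral1.
have lt_i : (i < (size p).-1)%N by rewrite ltn_neqAle ne_i -ltnS prednK.
rewrite -(subnSK lt_i) exprSr -mulrA -rmorphXn; apply: integral_mul.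
  exact: integral_id.
by apply: bp; exact: mem_nth.
Qed.

End AlgebraicElements.

(** * Transitivity of algebraicity and Zariski's lemma *)

Lemma alg_over_trans (A B : comNzRingType) (K : fieldType)
    (f : {rmorphism A -> K}) (g : {rmorphism B -> K}) z :
  (forall b, alg_over f (g b)) -> alg_over g z -> alg_over f z.
Proof.
move=> algg [b b0 [p mon_p pz]]; rewrite -(mulKf b0 z); apply: alg_over_mul.
  exact: alg_over_inv.
apply: (@alg_over_root_monic _ _ _ (map_poly g p)); rewrite ?monic_map // => i.
by rewrite coef_map; exact: algg.
Qed.

(* Stated through all subrings closed under division by the image of f, so that
   being generated by x :: xs over A turns at once into being generated by xs
   over {poly A}, mapped to K by evaluation at x. *)
Definition generated_over (A : comNzRingType) (K : fieldType)
    (f : {rmorphism A -> K}) (xs : seq K) : Prop :=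
  forall T : K -> Prop,
    (forall a, T (f a)) ->
    (forall x y, T x -> T y -> T (x - y)) ->
    (forall x y, T x -> T y -> T (x * y)) ->
    (forall x a, T x -> T (x / f a)) ->
    (forall x, x \in xs -> T x) ->
  forall z, T z.

(** The rational root argument: once denominators are cleared, every term but the leading one is
    divisible by [u]. *)
Lemma root_frac_dvd (A : comNzRingType) (K : fieldType)
    (f : {rmorphism A -> K}) (p : {poly A}) (u w : A) :
    p \is monic -> f u != 0 -> root (map_poly f p) (f w / f u) ->
  exists g, f (w ^+ (size p).-1 + u * g) = 0.
Proof.
move=> mon_p u0 pz; set m := (size p).-1.
have Sm : m.+1 = size p by rewrite prednK // size_poly_gt0 monic_neq0.
exists (\sum_(i < m) p`_i * w ^+ i * u ^+ (m - i.+1)).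
transitivity (f u ^+ m * (map_poly f p).[f w / f u]); last first.
  by rewrite (rootP pz) mulr0.
have le_m : (size (map_poly f p) <= m.+1)%N by rewrite Sm size_poly.
rewrite (horner_coef_wide _ le_m) big_ord_recr /=.
rewrite rmorphD rmorphXn rmorphM rmorph_sum mulrDr [RHS]addrC; congr (_ + _).
  have -> : (map_poly f p)`_m = 1.
    have p_m : p`_m = 1 by exact/eqP.
    by rewrite coef_map /= p_m rmorph1.
  by rewrite mul1r expr_div_n mulrC divfK // expf_neq0.
rewrite !mulr_sumr; apply: eq_bigr => i _.
rewrite coef_map !rmorphM !rmorphXn /=.
have -> : f u ^+ m = f u ^+ (m - i.+1) * (f u * f u ^+ i).
  by rewrite -exprS -exprD subnK.
by rewrite expr_div_n; field; rewrite expf_neq0.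
Qed.

(** Induction on the generators, with [x] moved into the coefficients [{poly A}]. If [x] is
    transcendental, powers of one [a] and factors from [A] suffice to make any element of [K]
    integral, which fails for the inverse of ['X * a + 1]. *)
Theorem zariski_alg (K : fieldType) (xs : seq K) (A : comNzRingType)
    (f : {rmorphism A -> K}) :
  generated_over f xs -> forall z, alg_over f z.
Proof.
elim: xs A f => [|x xs IHxs] A f gen.
  apply: gen => //.
  - exact: alg_over_id.
  - exact: alg_over_sub.
  - exact: alg_over_mul.
  - by move=> x a algx; exact/alg_over_mul/alg_over_inv/alg_over_id.
pose g : {rmorphism {poly A} -> K} :=
  horner_morph (fun a => mulrC x (f a) : GRing.comm _ _).
have gE q : g q = (map_poly f q).[x] by [].
have gC a : g a%:P = f a by exact: horner_morphC.
have gX : g 'X = x by exact: horner_morphX.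
have {}IHxs : forall z, alg_over g z.
  apply: IHxs => T Tf Tsub Tmul Tdiv Txs; apply: gen => //.
  - by move=> a; rewrite -gC.
  - by move=> y a Ty; rewrite -gC; exact: Tdiv.
  - by move=> y; rewrite inE => /predU1P[->|/Txs //]; rewrite -gX.
have [algx|transx] := EM (alg_over f x).
  move=> z; apply: (alg_over_trans (g := g)) => //.
  elim/poly_ind => [|p a algp].
    by rewrite rmorph0 -(rmorph0 f); exact: alg_over_id.
  rewrite rmorphD rmorphM gX gC; apply: alg_over_add; last exact: alg_over_id.
  exact: alg_over_mul.
(* A nonzero image, divided by its leading coefficient, would give [x] a monic equation with
   algebraic coefficients. *)
have g_inj q : g q = 0 -> map_poly f q = 0.
  move=> q0; apply/eqP/negPn/negP => fq0; apply: transx.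
  have lead0 : lead_coef (map_poly f q) != 0 by rewrite lead_coef_eq0.
  pose r := (lead_coef (map_poly f q))^-1 *: map_poly f q.
  apply: (@alg_over_root_monic _ _ _ r).
  - by rewrite monicE lead_coefZ mulVf.
  - by rewrite rootE hornerZ -gE q0 mulr0.
  move=> i; rewrite coefZ lead_coefE !coef_map.
  by apply/alg_over_mul/alg_over_id/alg_over_inv/alg_over_id.
have [a ga0 axs] := common_denominator (fun z (_ : z \in xs) => IHxs z).
have fa0 : map_poly f a != 0.
  by apply: contraNneq ga0; rewrite gE => ->; rewrite horner0.
(* The element 1 / g u lies in K, although u is coprime to every denominator
   that occurs there. *)
pose u := 'X * a + 1.
have size_u : (1 < size (map_poly f u))%N.
  rewrite rmorphD rmorphM rmorph1 /= map_polyX mulrC size_polyDl size_mulX //.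
    by rewrite ltnS size_poly_gt0.
  by rewrite size_poly1 ltnS size_poly_gt0.
have gu0 : g u != 0.
  by apply: contraTneq size_u => /g_inj ->; rewrite size_poly0.
(* The elements made integral by some [f c * g a ^+ N] satisfy all closure conditions of [gen], so
   they exhaust [K]. *)
have [N [c fc0]] : exists N, exists2 c, f c != 0 &
    integralOver g (f c * g a ^+ N * (g u)^-1).
  have intA b : integralOver g (f b) by rewrite -gC; exact: integral_id.
  have intX n : integralOver g (g a ^+ n).
    by rewrite -rmorphXn; exact: integral_id.
  apply: (gen (fun z => exists N, exists2 c, f c != 0 &
    integralOver g (f c * g a ^+ N * z))).
  - by move=> b; exists 0, 1; rewrite rmorph1 ?oner_eq0 // !mul1r.
  - move=> y z [M [b b0 y_int]] [N [c c0 z_int]]; exists (M + N)%N, (b * c).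
      by rewrite rmorphM mulf_neq0.
    have -> : f (b * c) * g a ^+ (M + N) * (y - z) =
        f c * g a ^+ N * (f b * g a ^+ M * y) -
        f b * g a ^+ M * (f c * g a ^+ N * z).
      by rewrite rmorphM exprD; ring.
    by apply: integral_sub; do 2!apply: integral_mul => //.
  - move=> y z [M [b b0 y_int]] [N [c c0 z_int]]; exists (M + N)%N, (b * c).
      by rewrite rmorphM mulf_neq0.
    have -> : f (b * c) * g a ^+ (M + N) * (y * z) =
        (f b * g a ^+ M * y) * (f c * g a ^+ N * z).
      by rewrite rmorphM exprD; ring.
    exact: integral_mul.
  - move=> y d [N [c c0 y_int]].
    (* Closure must also cover [f d = 0], where the quotient is 0 by convention. *)
    have [->|d0] := eqVneq (f d) 0.
      exists 0, 1; rewrite rmorph1 ?oner_eq0 // invr0 !mulr0.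
      exact: integral0.
    exists N, (c * d); first by rewrite rmorphM mulf_neq0.
    have -> : f (c * d) * g a ^+ N * (y / f d) = f c * g a ^+ N * y.
      by rewrite rmorphM; field.
    by [].
  move=> y; rewrite inE => /predU1P[->|/axs y_int]; last first.
    by exists 1, 1; rewrite rmorph1 ?oner_eq0 // mul1r expr1.
  exists 0, 1; rewrite rmorph1 ?oner_eq0 // !mul1r -gX; exact: integral_id.
rewrite -gC -rmorphXn -rmorphM => -[p mon_p pz].
have [h /g_inj] := root_frac_dvd mon_p gu0 pz.
set m := (size p).-1.
rewrite rmorphD rmorphM rmorphXn rmorphM rmorphXn /= map_polyC /= => /eqP.
rewrite addr_eq0 => /eqP E.
(* Modulo [u] the product ['X * a] is -1, so [u] is coprime to [a] and to constants; dividing this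
   power, it would have to be constant. *)
have u_dvd : map_poly f u %| ((f c)%:P * map_poly f a ^+ N) ^+ m.
  by rewrite E -mulrN dvdp_mulr.
have /coprimepP/(_ _ (dvdpp _) u_dvd) :
    coprimep (map_poly f u) (((f c)%:P * map_poly f a ^+ N) ^+ m).
  apply/coprimep_expr; rewrite mul_polyC coprimepZr //.
  apply/coprimep_expr; rewrite coprimep_sym rmorphD rmorphM rmorph1 /=.
  by rewrite coprimep_addl_mul coprimep1.
by rewrite -size_poly_eq1 => /eqP S; rewrite S in size_u.
Qed.

(** * The residue field of a prime ideal *)

Lemma fraction_ratio (D : idomainType) (r : {ratio D}) :
  \pi_{fraction D} r * FracField.tofrac \d_r = FracField.tofrac \n_r.
Proof.
unlock FracField.tofrac; rewrite -[LHS]FracField.pi_mul; apply/eqmodP => /=.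
rewrite FracField.equivfE /FracField.mulf.
by rewrite !numden_Ratio ?mulf_neq0 ?oner_eq0 ?denom_ratioP //= !mulr1 mulrC.
Qed.

Section PrimeQuotient.

Variables (R : comNzRingType) (P : {pred R}) (primeP : prime_ideal P).

(** The alias carries the primality proof from which the ideal structures are inferred. *)
Definition ideal_of of prime_ideal P : {pred R} := P.

HB.instance Definition _ :=
  isIdealr.Build R (ideal_of primeP) (proj1 primeP).
HB.instance Definition _ :=
  isPrimeIdealrClosed.Build R (ideal_of primeP) (proj2 primeP).

Definition prime_quot : Type := {ideal_quot (ideal_of primeP)}.

HB.instance Definition _ := GRing.ComNzRing.on prime_quot.

Let invertible : pred prime_quot := fun x => `[< exists y, y * x = 1 >].

(* {ideal_quot _} comes without the inverse function that an idomainType,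
   hence a fraction field, requires. *)
Let inverse (x : prime_quot) : prime_quot :=
  if pselect (exists y, y * x = 1) is left ex then projT1 (cid ex) else x.

Let mulVx : {in invertible, left_inverse 1 inverse *%R}.
Proof.
move=> x /asboolP ex; rewrite /inverse; case: pselect => // ex'.
by case: cid.
Qed.

Let invertibleP x y : y * x = 1 -> invertible x.
Proof. by move=> E; apply/asboolP; exists y. Qed.

Let inverse_out : {in [predC invertible], inverse =1 id}.
Proof.
by move=> x /asboolPn nex; rewrite /inverse; case: pselect.
Qed.

HB.instance Definition _ := GRing.ComNzRing_hasMulInverse.Build prime_quot
  mulVx invertibleP inverse_out.

Let prime_quot_integral (x y : prime_quot) :
  x * y = 0 -> (x == 0) || (y == 0).
Proof. exact: (@Quotient.rquot_IdomainAxiom _ (ideal_of primeP)). Qed.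

HB.instance Definition _ :=
  GRing.ComUnitRing_isIntegral.Build prime_quot prime_quot_integral.

(** [K] is the residue field at [P], the fraction field of [R / P]. *)
Lemma prime_ideal_field : exists (K : fieldType) (h : {rmorphism R -> K}),
  (forall x, (h x == 0) = (x \in P)) /\
  (forall z, exists2 ab, h ab.2 != 0 & z = h ab.1 / h ab.2).
Proof.
pose proj : {rmorphism R -> {ideal_quot (ideal_of primeP)}} :=
  \pi_{ideal_quot (ideal_of primeP)}.
pose emb :
    {rmorphism {ideal_quot (ideal_of primeP)} -> {fraction prime_quot}} :=
  (@FracField.tofrac prime_quot : {rmorphism prime_quot -> _}).
have proj_surj x : exists a, proj a = x.
  by exists (repr x); rewrite /proj /= reprK.
have kerh x : ((emb \o proj) x == 0) = (x \in P).
  rewrite /= tofrac_eq0; transitivity (proj x == proj 0).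
    by rewrite rmorph0.
  by rewrite /= -Quotient.idealrBE subr0.
exists {fraction prime_quot}, (emb \o proj); split=> // z.
elim/quotW: z => r.
have [a Ea] := proj_surj (frac r).1; have [b Eb] := proj_surj (frac r).2.
have b0 : emb (proj b) != 0 by rewrite tofrac_eq0 Eb denom_ratioP.
exists (a, b) => //; apply: (canRL (mulfK b0)).
by rewrite /= Ea Eb; exact: fraction_ratio.
Qed.

End PrimeQuotient.

(** * Prime ideals disjoint from a multiplicative set *)

(** An ideal [M] maximal among those containing [I] and missing [W] is prime: if [u] and [v] lie
    outside it, adjoining either yields an element of [W], and the product of these two would lie in
    [M] along with [u * v]. *)
Lemma prime_ideal_disjoint (R : comNzRingType) (W : R -> Prop) (I : set R) :
    mult_set W -> I 0 -> (forall a u v, I u -> I v -> I (a * u + v)) ->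
    (forall w, W w -> ~ I w) ->
  exists Q : {pred R},
    [/\ prime_ideal Q, forall x, I x -> x \in Q & forall w, W w -> w \notin Q].
Proof.
move=> [W1 WM] I0 Iclosed IW.
pose good (M : set R) := [/\ forall a u v, M u -> M v -> M (a * u + v) &
  forall w, W w -> ~ M w].
(* Zorn_bigcup covers the empty chain too, hence the union with I. *)
have [F Fgood Ftot|A [[Mclosed MW] Amax]] :=
  @Zorn_bigcup R (fun J => good (I `|` J)%classic).
  have cover x y : (I `|` \bigcup_(X in F) X)%classic x ->
      (I `|` \bigcup_(X in F) X)%classic y ->
      exists Z, [/\ good (I `|` Z)%classic, (Z `<=` \bigcup_(X in F) X)%classic,
                    (I `|` Z)%classic x & (I `|` Z)%classic y].
    have FZ Z : F Z -> (Z `<=` \bigcup_(X in F) X)%classic.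
      by move=> FZ z Zz; exists Z.
    move=> [Ix|[X FX Xx]] [Iy|[Y FY Yy]].
    - by exists set0; split; [rewrite setU0 | | left | left].
    - by exists Y; split; [exact: Fgood | exact: FZ | left | right].
    - by exists X; split; [exact: Fgood | exact: FZ | right | left].
    - have [XY|YX] := Ftot _ _ FX FY.
        exists Y; split; [exact: Fgood | exact: FZ | | by right].
        by right; exact: XY.
      exists X; split; [exact: Fgood | exact: FZ | by right |].
      by right; exact: YX.
  split=> [a u v Mu Mv|w Ww Mw].
    have [Z [[Zclosed _] ZF Zu Zv]] := cover _ _ Mu Mv.
    by have [|/ZF] := Zclosed a _ _ Zu Zv; [left|right].
  by have [Z [[_ ZW] _ Zw _]] := cover _ _ Mw Mw; exact: ZW Zw.
set M := (I `|` A)%classic in Mclosed MW Amax.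
have M0 : M 0 by left.
have Mmul a u : M u -> M (a * u).
  by move=> Mu; rewrite -[_ * _]addr0; exact: Mclosed.
have Madd u v : M u -> M v -> M (u + v) by rewrite -{2}[u]mul1r; exact: Mclosed.
have meet u : ~ M u ->
    exists2 w, W w & exists r, exists2 m, M m & w = r * u + m.
  move=> Mu; apply: contrapT => noW.
  (* [B] is the ideal generated by [M] and [u]; by maximality it meets [W]. *)
  pose B : set R := fun x => exists r, exists2 m, M m & x = r * u + m.
  have MB x : M x -> B x by exists 0, x; rewrite // mul0r add0r.
  have Bu : B u by exists 1, 0; rewrite // mul1r addr0.
  have IBE : (I `|` B)%classic = B.
    by apply/seteqP; split=> [x [Ix|//]|x Bx]; [apply: MB; left | right].
  apply: (Amax B).
    split=> [x Ax|BA]; first by apply: MB; right.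
    by apply: Mu; right; exact: BA.
  rewrite IBE; split=> [a x y [r [m Mm ->]] [s [n Mn ->]]|w Ww Bw].
    exists (a * r + s), (a * m + n); first exact: Mclosed.
    by ring.
  by apply: noW; exists w.
exists (fun x => `[< M x >]); split.
- split; [split|].
  + exact/asboolP.
  + by apply/asboolP; exact: MW.
  + by move=> a u v /asboolP Mu /asboolP Mv; apply/asboolP; exact: Mclosed.
  move=> u v /asboolP Muv; apply/orP.
  have [Mu|/meet[w Ww [r [m Mm Ew]]]] := EM (M u); first by left; apply/asboolP.
  have [Mv|/meet[x Wx [s [n Mn Ex]]]] := EM (M v).
    by right; apply/asboolP.
  case: (MW _ (WM _ _ Ww Wx)); rewrite Ew Ex.
  have -> : (r * u + m) * (s * v + n) =
      r * s * (u * v) + ((s * v + n) * m + r * u * n) by ring.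
  by apply/Madd/Madd; exact: Mmul.
- by move=> x Ix; apply/asboolP; left.
- by move=> w Ww; apply/asboolP; exact: MW.
Qed.

(** * Units and unit-additivity of localizations *)

Lemma localization_unitP (R : comNzRingType) (W : R -> Prop) (mW : mult_set W)
    (p : Localization.prefrac W) :
  is_unit (\pi_(localization mW) p : localization mW) <->
  saturation W (Localization.num p).
Proof.
split=> [[y]|[y Wpy]].
  elim/quotW: y => q; rewrite -[LHS]Localization.pi_mul => /eqP.
  move=> /(Localization.piP mW)[u Wu].
  rewrite /Localization.num /Localization.den /=.
  rewrite mulr1 mul1r mulrBr => /eqP; rewrite subr_eq0 => /eqP E.
  exists (u * Localization.num q); rewrite mulrCA E.
  by do 2!apply: (mW.2) => //; exact: Localization.denP.
pose q := Localization.mkfrac (Localization.den p * y) Wpy.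
exists (\pi_(localization mW) q).
rewrite -[LHS]Localization.pi_mul; apply: Localization.pi_eq.
by do 2!rewrite /Localization.num /Localization.den /=; ring.
Qed.

Lemma localization_unit_additive (R : comNzRingType) (W : R -> Prop)
    (mW : mult_set W) :
    (forall a b, saturation W a -> saturation W b ->
       a + b = 0 \/ saturation W (a + b)) ->
  unit_additive (localization mW).
Proof.
move=> addV; elim/quotW=> p; elim/quotW=> q.
move=> /localization_unitP Vp /localization_unitP Vq.
have mulV a w : saturation W a -> W w -> saturation W (a * w).
  by move=> [y Way] Ww; exists y; rewrite mulrAC; exact: (mW.2).
rewrite -[_ + _]Localization.pi_add.
have [E|V] := addV _ _ (mulV _ _ Vp (Localization.denP q))
                       (mulV _ _ Vq (Localization.denP p)); last first.
  by left; apply/localization_unitP.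
right; exists 1; rewrite expr1; apply: Localization.pi_eq.
by rewrite {1}/Localization.num /= E !mul0r.
Qed.

(** * Subrings, and integrality modulo a prime *)

Definition subring_pred (R : comNzRingType) (S : {pred R})
  of subring_closed S : {pred R} := S.

Section Subring.

Variables (R : comNzRingType) (S : {pred R}) (S_closed : subring_closed S).

HB.instance Definition _ :=
  GRing.isSubringClosed.Build R (subring_pred S_closed) S_closed.

Definition subring := {x : R | x \in subring_pred S_closed}.

HB.instance Definition _ := SubChoice.on subring.
HB.instance Definition _ := [SubChoice_isSubComNzRing of subring by <:].

End Subring.

(** By the last hypothesis every denominator in the residue field at [P] divides the image of an
    element of [W], which comes from [A]. So [xs] generates that field over [A], and Zariski's lemma
    applies. *)
Lemma integral_multiple_mod_prime (R : comNzRingType) (A : comNzRingType)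
    (g : {rmorphism A -> R}) (xs : seq R) (W : R -> Prop) (P : {pred R}) :
    (forall T : R -> Prop, (forall a, T (g a)) ->
       (forall x y, T x -> T y -> T (x - y)) ->
       (forall x y, T x -> T y -> T (x * y)) ->
       (forall x, x \in xs -> T x) -> forall r, T r) ->
    prime_ideal P -> (forall w, W w -> w \notin P) ->
    (forall w, W w -> exists a, g a = w) ->
    (forall r, r \notin P -> exists c, exists2 w, W w & r * c - w \in P) ->
  forall s, exists2 b, g b \notin P &
    exists2 p : {poly A}, p \is monic & (map_poly g p).[g b * s] \in P.
Proof.
move=> gen primeP WP gW inv s.
have [K [h [kerh fracK]]] := prime_ideal_field primeP.
pose f : {rmorphism A -> K} := h \o g.
have genf : generated_over f [seq h x | x <- xs].
  move=> T Tf Tsub Tmul Tdiv Txs z.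
  have Th r : T (h r).
    apply: (gen (fun r => T (h r))) => //.
    - by move=> x y; rewrite rmorphB; exact: Tsub.
    - by move=> x y; rewrite rmorphM; exact: Tmul.
    - by move=> x xxs; apply/Txs/map_f.
  have [[a b] /= hb0 ->] := fracK z.
  have [|c [w Ww]] := inv b; first by rewrite -kerh.
  have [d gd] := gW _ Ww.
  rewrite -kerh rmorphB rmorphM subr_eq0 => /eqP E.
  have hc0 : h c != 0.
    have : h w != 0 by rewrite kerh WP.
    by apply: contraNneq => hc0; rewrite -E hc0 mulr0.
  have -> : h a / h b = h (a * c) / f d.
    by rewrite /f /= gd -E rmorphM; field; rewrite hb0 hc0.
  exact: Tdiv.
have [b fb0 [p mon_p]] := zariski_alg genf (h s).
rewrite /f /= -rmorphM map_poly_comp rootE horner_map kerh => pP.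
by exists b; [rewrite -kerh | exists p].
Qed.

(** * Finite sums and the sets [W n] and [V n] *)

(** The empty sum is allowed, so that over a domain the sums from [V n] are [W n.+1] together with
    0. *)
Definition is_sum (R : nmodType) (V : R -> Prop) (x : R) : Prop :=
  exists2 s : seq R, forall y, y \in s -> V y & x = \sum_(y <- s) y.

Section SumClosure.

Variables (R : comNzRingType) (V : R -> Prop).

Lemma is_sum0 : is_sum V 0.
Proof. by exists [::]; rewrite ?big_nil. Qed.

Lemma is_sum1 x : V x -> is_sum V x.
Proof.
by move=> Vx; exists [:: x]; rewrite ?big_seq1 // => y /[!inE] /eqP ->.
Qed.

Lemma is_sumD x y : is_sum V x -> is_sum V y -> is_sum V (x + y).
Proof.
move=> [s Vs ->] [t Vt ->]; exists (s ++ t); last by rewrite big_cat.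
by move=> z; rewrite mem_cat => /orP[/Vs|/Vt].
Qed.

Lemma is_sumM x y :
    (forall a b, V a -> V b -> V (a * b)) ->
  is_sum V x -> is_sum V y -> is_sum V (x * y).
Proof.
move=> VM [s Vs ->] [t Vt ->]; exists [seq a * b | a <- s, b <- t].
  by move=> _ /allpairsP[[a b] /= [/Vs Va /Vt Vb ->]]; exact: VM.
rewrite big_allpairs_dep mulr_suml; apply: eq_bigr => a _.
by rewrite mulr_sumr.
Qed.

End SumClosure.

Section UnitDimensionSets.

Variable R : idomainType.

Local Notation W n := (udimW (R := R) n).
Local Notation V n := (saturation (udimW (R := R) n)).

Let W_mult n : mult_set (W n) := udimW_mult_set (domain_prime_nilradical R) n.

Lemma nilpotent_domain (x : R) : nilpotent_elt x <-> x = 0.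
Proof.
split=> [[n /eqP]|->]; last by exists 1; rewrite expr1.
by rewrite expf_eq0 => /andP[_ /eqP].
Qed.

Lemma udimW_neq0 n (x : R) : W n x -> x != 0.
Proof.
case: n => [->|n [nil_x _]]; first exact: oner_neq0.
by apply/eqP => /nilpotent_domain.
Qed.

Lemma udimV_neq0 n (x : R) : V n x -> x != 0.
Proof.
by move=> [y /udimW_neq0]; apply: contraNneq => ->; rewrite mul0r.
Qed.

Lemma udimWS n (x : R) : W n.+1 x <-> x != 0 /\ is_sum (V n) x.
Proof.
split=> [Wx|[/eqP x0 Sx]]; first by split; [exact: udimW_neq0 Wx | case: Wx].
by split=> // /nilpotent_domain.
Qed.

Lemma udimW_V n (x : R) : W n x -> V n x.
Proof. by exists 1; rewrite mulr1. Qed.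

Lemma udimV_WS n (x : R) : V n x -> W n.+1 x.
Proof.
by move=> Vx; apply/udimWS; split; [exact: udimV_neq0 Vx | exact: is_sum1].
Qed.

Lemma unit_udimV n (x y : R) : x * y = 1 -> V n x.
Proof. by move=> xy1; exists y; rewrite xy1; exact: (W_mult n).1. Qed.

Lemma udimV_mul n (x y : R) : V n x -> V n y -> V n (x * y).
Proof.
move=> [x' Wx] [y' Wy]; exists (x' * y'); rewrite mulrACA.
exact: (W_mult n).2.
Qed.

Lemma udimV_factor n (x y : R) : V n (x * y) -> V n x.
Proof. by move=> [z Wz]; exists (y * z); rewrite mulrA. Qed.

Lemma unit_additive_udimW n :
    (forall s : R, W n.+1 s -> V n s) ->
  unit_additive (localization (udimW_mult_set (domain_prime_nilradical R) n)).
Proof.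
move=> WV; apply: localization_unit_additive => a b Va Vb.
have [|ab0] := eqVneq (a + b) 0; first by left.
by right; apply/WV/udimWS; split=> //; apply: is_sumD; exact: is_sum1.
Qed.

(** [A] is [k] for [n = 0], and the subring made of 0 and [W n] for positive [n]; the latter
    contains the image of [k] because nonzero constants are units. *)
Lemma udim_coefficients (k : fieldType) (phi : {rmorphism k -> R}) n :
  exists (A : comNzRingType) (g : {rmorphism A -> R}),
    [/\ forall a, g a != 0 -> V n (g a), forall w, W n w -> exists a, g a = w
      & forall c, exists a, g a = phi c].
Proof.
have phiV m c : phi c != 0 -> V m (phi c).
  move=> c0; apply: (@unit_udimV m _ (phi c^-1)).
  rewrite -rmorphM mulfV ?rmorph1 //.
  by rewrite -(fmorph_eq0 phi).
case: n => [|n].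
  exists k, phi; split; [exact: phiV | | by move=> c; exists c].
  by move=> w ->; exists 1; rewrite rmorph1.
pose S : {pred R} := fun x => `[< is_sum (V n) x >].
have S_closed : subring_closed S.
  split=> [|x y /asboolP Sx /asboolP Sy|x y /asboolP Sx /asboolP Sy].
  - by apply/asboolP/is_sum1; apply: (@unit_udimV n _ 1); rewrite mulr1.
  (* Differences are again sums because -1 is a unit, hence in [V n]. *)
  - apply/asboolP/is_sumD => //; rewrite -mulN1r; apply: is_sumM => //.
      exact: udimV_mul.
    by apply/is_sum1; apply: (@unit_udimV n _ (-1)); rewrite mulrNN mulr1.
  - by apply/asboolP/is_sumM => //; exact: udimV_mul.
have lift x : is_sum (V n) x -> exists a : subring S_closed, \val a = x.
  by move=> Sx; exists (Sub x (asboolT Sx)); rewrite SubK.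
exists (subring S_closed), (\val : {rmorphism subring S_closed -> R}); split.
- move=> a a0; apply: udimW_V; apply/udimWS; split=> //.
  exact/asboolP/(valP a).
- by move=> w /udimWS[_] /lift.
move=> c; apply: lift; have [->|c0] := eqVneq (phi c) 0; first exact: is_sum0.
exact/is_sum1/phiV.
Qed.

(** * Enlarging a prime while descending from [W n.+1] to [W n] *)

Lemma udim_prime_step (k : fieldType) (phi : {rmorphism k -> R})
    (phi_ft : finite_type phi) (P : {pred R}) n (s : R) :
    prime_ideal P -> (forall w, W n.+1 w -> w \notin P) ->
    W n.+1 s -> ~ V n s ->
  exists Q : {pred R}, [/\ prime_ideal Q, forall w, W n w -> w \notin Q,
    {subset P <= Q} & ~ {subset Q <= P}].
Proof.
move=> primeP WP Ws nVs; apply: contrapT => noQ; apply: nVs.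
have [[P0 P1 Plin] _] := primeP.
have WnP w : W n w -> w \notin P by move=> Ww; apply/WP/udimV_WS/udimW_V.
(* Otherwise [P] and [r] generate an ideal missing [W n], and a prime that contains it and still
   misses [W n] is the excluded [Q]. *)
have inv r : r \notin P -> exists c, exists2 w, W n w & r * c - w \in P.
  move=> rP; apply: contrapT => noinv; apply: noQ.
  have [||||Q [primeQ IQ QW]] := @prime_ideal_disjoint R (W n)
      (fun x => exists c, r * c - x \in P) => //.
  - by exists 0; rewrite mulr0 subr0.
  - move=> a u v [c uP] [d vP]; exists (a * c + d).
    have -> : r * (a * c + d) - (a * u + v) =
        a * (r * c - u) + (r * d - v) by ring.
    exact: Plin.
  - by move=> w Ww [c cP]; apply: noinv; exists c, w.
  exists Q; split=> // [x xP|QP].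
    apply: IQ; exists 0; rewrite mulr0 sub0r -[- x]addr0 -mulN1r.
    exact: Plin.
  move/negP: rP; apply; apply/QP/IQ; exists 1.
  by rewrite mulr1 subrr.
have [A [g [gV Wg phig]]] := udim_coefficients phi n.
have [m [x genx]] := phi_ft.
have [|b gbP [p mon_p pP]] :=
  @integral_multiple_mod_prime R A g (codom x) (W n) P _ primeP WnP Wg inv s.
- move=> T Tg Tsub Tmul Tx r.
  have Tadd y z : T y -> T z -> T (y + z).
    move=> Ty Tz; rewrite -[z]opprK -[- z]sub0r -(rmorph0 g).
    by do 2!apply: (Tsub) => //.
  have [q ->] := genx r.
  rewrite /mpoly.mmap; elim/big_ind: _ => [|//|mon _].
    by rewrite -(rmorph0 g).
  have [a <-] := phig (mpoly.mcoeff mon q).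
  apply: (Tmul) => //; rewrite /mpoly.mmap1.
  elim/big_ind: _ => [|//|i _]; first by rewrite -(rmorph1 g).
  elim: (mpoly.fun_of_multinom mon i) => [|e IHe].
    by rewrite expr0 -(rmorph1 g).
  by rewrite exprS; apply: (Tmul) => //; apply: Tx; exact: codom_f.
set t := g b * s in pP.
have gb0 : g b != 0 by apply: contraNneq gbP => ->.
have s0 : s != 0 := udimW_neq0 Ws.
have t0 : t != 0 by rewrite mulf_neq0.
have sumg a : is_sum (V n) (g a).
  have [->|ga0] := eqVneq (g a) 0; first exact: is_sum0.
  exact/is_sum1/gV.
have sumt : is_sum (V n) t.
  apply: is_sumM => //; first exact: udimV_mul.
  by have /udimWS[] := Ws.
have sump (q : {poly A}) : is_sum (V n) (map_poly g q).[t].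
  elim/poly_ind: q => [|q c IHq].
    by rewrite rmorph0 horner0; exact: is_sum0.
  rewrite rmorphD rmorphM /= map_polyX map_polyC hornerMXaddC.
  apply: is_sumD (sumg c); apply: is_sumM => //; exact: udimV_mul.
(* The value is a sum from [V n] lying in [P]; if nonzero it would be in [W n.+1], which misses
   [P]. *)
have pt : root (map_poly g p) t.
  apply/eqP/eqP; apply: contraTT pP => pt0.
  by apply: WP; apply/udimWS.
have gp0 : map_poly g p != 0 by rewrite monic_neq0 ?monic_map.
(* [s] divides [t], which divides a nonzero coefficient, an element of [V n]; a factor of an element
   of [V n] is in [V n]. *)
have [i] := root_dvd_coef gp0 pt t0; rewrite coef_map /= => gpi0 E.
apply: (@udimV_factor n s (- (g b * (drop_poly i.+1 (map_poly g p)).[t]))).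
have -> : s * - (g b * (drop_poly i.+1 (map_poly g p)).[t]) = g p`_i.
  by rewrite E /t; ring.
exact: gV.
Qed.

End UnitDimensionSets.

(** * The chain of primes and the comparison of dimensions *)

Theorem theorem6p7 (k : fieldType) (R : idomainType) (phi : {rmorphism k -> R})
    (phi_ft : finite_type phi) :
  (udim (domain_prime_nilradical R) <= krull_dim R)%E.
Proof.
rewrite /krull_dim /least_or_infty; case: pselect => [exb|_]; last exact: leey.
case: ex_minnP => b /asboolP chain_le _.
suff [n le_nb addn] : exists2 n, (n <= b)%N & unit_additive
    (localization (udimW_mult_set (domain_prime_nilradical R) n)).
  rewrite /udim /least_or_infty; case: pselect => [ex|[]]; last first.
    by exists n; apply/asboolP.
  case: ex_minnP => m _ m_min; rewrite lee_fin lez_nat.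
  by apply: leq_trans le_nb; apply/m_min/asboolP.
apply: contrapT => nadd.
have step n : (n <= b)%N ->
    exists2 s : R, udimW n.+1 s & ~ saturation (udimW n) s.
  move=> le_nb; apply: contrapT => nos; apply: nadd; exists n => //.
  apply: unit_additive_udimW => s Ws; apply: contrapT => nVs.
  by apply: nos; exists s.
(* Each new prime lowers by one the index of the set it misses; starting from [W b.+1] there is room
   for [b.+1] steps, one more than the bound [b] permits. *)
have chain m : (m <= b.+1)%N -> exists P : nat -> {pred R},
    [/\ forall i, (i <= m)%N -> prime_ideal (P i),
        forall i, (i < m)%N ->
          {subset P i <= P i.+1} /\ ~ {subset P i.+1 <= P i}
      & forall w : R, udimW (b.+1 - m) w -> w \notin P m].
  elim: m => [_|m IHm lt_mb].
    (* The chain starts at the zero ideal, the nilradical of a domain. *)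
    exists (fun _ => nilradical R); split=> // [i _|w /udimW_neq0 w0].
      exact: domain_prime_nilradical.
    by apply/asboolPn => /nilpotent_domain/eqP; exact/negP.
  have [P [primeP ltP WP]] := IHm (ltnW lt_mb).
  have [s Ws nVs] := step _ (leq_subr m b).
  rewrite subSn // in WP.
  have [Q [primeQ WQ PQ QP]] :=
    udim_prime_step phi_ft (primeP _ (leqnn m)) WP Ws nVs.
  exists (fun i => if (i <= m)%N then P i else Q); split=> [i|i|w].
  - by case: (leqP i m) => [le_im|_] _ //; exact: primeP.
  - move=> le_im; have /predU1P[->|lt_im] : (i == m) || (i < m)%N.
        by rewrite -leq_eqVlt.
      by rewrite leqnn ltnn.
    by rewrite (ltnW lt_im) lt_im; exact: ltP.
  by rewrite ltnn subSS; exact: WQ.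
have [P [primeP ltP _]] := chain _ (leqnn b.+1).
have /chain_le : prime_chain R b.+1 by exists P.
by rewrite ltnn.
Qed.
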